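(* Let $\beta\in(1,3/2)$ and let $R=\{\tau_1,\ldots,\tau_6;p_1,\ldots,p_6\}$ be the random map described in the context. Then $R$ admits an absolutely continuous invariant measure, i.e. there is a probability measure $\mu$ on $S_\beta$, absolutely continuous with respect to Lebesgue measure, such that $\mu(A)=\sum_{k=1}^6 p_k\,\mu(\tau_k^{-1}(A))$ for every Borel set $A\subseteq S_\beta$.
   Context: $\vec q_0=(0,0)$, $\vec q_1=(1,0)$, $\vec q_2=(0,1)$; $S_\beta$ is the attractor of the IFS $f_{\vec q_i}(\vec z)=(\vec z+\vec q_i)/\beta$, which for $1<\beta<3/2$ is the closed triangle with vertices $(0,0)$, $(\frac1{\beta-1},0)$, $(0,\frac1{\beta-1})$. Subsets of $S_\beta$: $E_0=[0,\frac1\beta)\times[0,\frac1\beta)$; $E_1=\{0\le y<\frac1\beta,\ \frac{1}{\beta(\beta-1)}<x+y\le\frac{1}{\beta-1}\}$; $E_2=\{0\le x<\frac1\beta,\ \frac{1}{\beta(\beta-1)}<x+y\le\frac{1}{\beta-1}\}$; $C_{01}=\{x\ge\frac1\beta,\ 0\le y<\frac1\beta,\ x+y\le\frac{1}{\beta(\beta-1)}\}$; $C_{12}=\{x\ge\frac1\beta,\ y\ge\frac1\beta,\ \frac{1}{\beta(\beta-1)}<x+y\le\frac{1}{\beta-1}\}$; $C_{02}=\{0\le x<\frac1\beta,\ y\ge\frac1\beta,\ x+y\le\frac{1}{\beta(\beta-1)}\}$; $C_{012}=\{x\ge\frac1\beta,\ y\ge\frac1\beta,\ x+y\le\frac{1}{\beta(\beta-1)}\}$.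 For $k=1,\ldots,6$ define $\tau_k:S_\beta\to S_\beta$ by $\tau_k(\vec z)=\beta\vec z-a_k(\vec z)$, where: $a_k(\vec z)=\vec q_i$ for $\vec z\in E_i$ (all $k$); for $\vec z\in C_{ij}$, $ij\in\{01,12,02\}$, $a_k(\vec z)=\vec q_i$ if $k\in\{1,2,3\}$ and $a_k(\vec z)=\vec q_j$ if $k\in\{4,5,6\}$; for $\vec z\in C_{012}$, $a_k(\vec z)=\vec q_0$ if $k\in\{1,4\}$, $\vec q_1$ if $k\in\{2,5\}$, $\vec q_2$ if $k\in\{3,6\}$. Fix parameters $p\in(0,1)$ and $s,t>0$ with $s+t<1$, and let the (constant) probabilities be $p_1=ps$, $p_2=pt$, $p_3=p(1-s-t)$, $p_4=(1-p)s$, $p_5=(1-p)t$, $p_6=(1-p)(1-s-t)$. The random map $R$ applies $\tau_k$ with probability $p_k$. *)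

(* Defs.v *)
From HB Require Import structures.
From mathcomp Require Import all_boot all_order all_algebra.
From mathcomp Require Import all_classical all_reals all_analysis.
Set Implicit Arguments. Unset Strict Implicit. Unset Printing Implicit Defensive.
Import Order.TTheory GRing.Theory Num.Theory.
Local Open Scope classical_set_scope.
Local Open Scope ring_scope.

Section RandomMap.
Variable R : realType.
Variable beta : R.

Definition q0 : R * R := (0, 0).
Definition q1 : R * R := (1, 0).
Definition q2 : R * R := (0, 1).

Definition cb : R := 1 / (beta * (beta - 1)).
Definition db : R := 1 / (beta - 1).

Definition Sb : set (R * R) := [set z | 0 <= z.1 /\ 0 <= z.2 /\ z.1 + z.2 <= db].

Definition E0 : set (R * R) :=
  [set z | (0 <= z.1 < 1 / beta) /\ (0 <= z.2 < 1 / beta)].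
Definition E1 : set (R * R) :=
  [set z | (0 <= z.2 < 1 / beta) /\ (cb < z.1 + z.2 <= db)].
Definition E2 : set (R * R) :=
  [set z | (0 <= z.1 < 1 / beta) /\ (cb < z.1 + z.2 <= db)].
Definition C01 : set (R * R) :=
  [set z | 1 / beta <= z.1 /\ (0 <= z.2 < 1 / beta) /\ z.1 + z.2 <= cb].
Definition C12 : set (R * R) :=
  [set z | 1 / beta <= z.1 /\ 1 / beta <= z.2 /\ (cb < z.1 + z.2 <= db)].
Definition C02 : set (R * R) :=
  [set z | (0 <= z.1 < 1 / beta) /\ 1 / beta <= z.2 /\ z.1 + z.2 <= cb].
Definition C012 : set (R * R) :=
  [set z | 1 / beta <= z.1 /\ 1 / beta <= z.2 /\ z.1 + z.2 <= cb].

(* the digit a_k(z), for k = 1, ..., 6; the final default (outside S_beta)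
   is irrelevant *)
Definition adigit (k : nat) (z : R * R) : R * R :=
  if `[< E0 z >] then q0
  else if `[< E1 z >] then q1
  else if `[< E2 z >] then q2
  else if `[< C01 z >] then (if (k <= 3)%N then q0 else q1)
  else if `[< C12 z >] then (if (k <= 3)%N then q1 else q2)
  else if `[< C02 z >] then (if (k <= 3)%N then q0 else q2)
  else if `[< C012 z >] then
    (if (k == 1)%N || (k == 4)%N then q0
     else if (k == 2)%N || (k == 5)%N then q1 else q2)
  else q0.

Definition tau (k : nat) (z : R * R) : R * R :=
  (beta * z.1 - (adigit k z).1, beta * z.2 - (adigit k z).2).

End RandomMap.

Definition prob {R : realType} (p s t : R) (k : nat) : R :=
  match k with
  | 1 => p * s
  | 2 => p * t
  | 3 => p * (1 - s - t)
  | 4 => (1 - p) * s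
  | 5 => (1 - p) * t
  | 6 => (1 - p) * (1 - s - t)
  | _ => 0
  end.

Definition leb2 (R : realType) :=
  ((@lebesgue_measure R) \x (@lebesgue_measure R))%E.

(* Main.v *)
Require Import Defs.
From HB Require Import structures.
From mathcomp Require Import all_boot all_order all_algebra.
From mathcomp Require Import all_classical all_reals all_analysis.
From mathcomp Require Import measurable_realfun ring lra.
Import Order.TTheory GRing.Theory Num.Theory numFieldNormedType.Exports.
Local Open Scope classical_set_scope.
Local Open Scope ring_scope.

(** The n-step random map multiplies distances by beta^n, and its pieces are cut
    out by finitely many lines in only three directions, x = c, y = c and
    x + y = c. Push the uniform measure of the unit square forward n times and
    measure regularity by the smallest K such that translating by h along an axis
    changes the mass of every set by at most K|h|. A set and its translate are
    treated differently only in strips around the lines; parallel lines are a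
    definite distance apart, so whatever their number the strips of width w carry
    mass at most (K + C_n) w. This gives a Lasota-Yorke inequality
    K' <= 7 beta^-n K + C_n, whose factor 7 does not grow with n, hence a bound on
    K uniform in n. Averaging over the translations in [0,h]^2 yields
    nu(A) <= 2Kh + |A|/h^2, uniformly along the orbit. A limit of the Cesaro means
    along an ultrafilter exists set by set, is finitely additive and invariant, and
    the last bound makes it countably additive and absolutely continuous. *)

(** * Finitely additive probabilities on the plane *)

Definition is_content {R : realType} (nu : set (R * R) -> R) : Prop :=
  [/\ forall A, measurable A -> 0 <= nu A, nu setT = 1 &
      forall A B, measurable A -> measurable B -> A `&` B = set0 ->
        nu (A `|` B) = nu A + nu B].

Section content_lemmas.
Context {R : realType} {nu : set (R * R) -> R} (cnu : is_content nu).

Lemma content0 : nu set0 = 0.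
Proof.
case: cnu => _ _ /(_ set0 set0 measurable0 measurable0).
by rewrite setI0 setU0 => /(_ erefl); lra.
Qed.

Lemma content_le A B : measurable A -> measurable B -> A `<=` B ->
  nu A <= nu B.
Proof.
move=> mA mB AB; case: cnu => ge0 _ add.
have mBA : measurable (B `\` A) by exact: measurableD.
have := add _ _ mA mBA; rewrite setDUK// => ->; first by have := ge0 _ mBA; lra.
by apply/seteqP; split=> x //= [? []].
Qed.

Lemma content_leU A B : measurable A -> measurable B ->
  nu (A `|` B) <= nu A + nu B.
Proof.
move=> mA mB; case: cnu => ge0 _ add.
have mBA : measurable (B `\` A) by exact: measurableD.
have -> : A `|` B = A `|` (B `\` A).
  by apply/seteqP; split=> x /=; have [?|?] := pselect (A x); tauto.
rewrite add//; last by apply/seteqP; split=> x //= [? []].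
by rewrite lerD2l; apply: content_le => // x [].
Qed.

Lemma content_le1 A : measurable A -> nu A <= 1.
Proof.
by move=> mA; case: (cnu) => _ <- _; exact: content_le.
Qed.

End content_lemmas.

(** * Translations along the axes and bounded variation *)

Definition translate {R : realType} (e : bool) (h : R) (z : R * R) : R * R :=
  if e then (z.1, z.2 + h) else (z.1 + h, z.2).

Definition coord {R : realType} (e : bool) (z : R * R) : R :=
  if e then z.2 else z.1.

Section translations.
Context {R : realType}.
Implicit Types (e : bool) (h : R).

Lemma measurable_translate e h : measurable_fun setT (translate e h).
Proof.
by case: e; apply: measurable_fun_pair => //=;
  [exact: (measurable_funD measurable_snd (measurable_cst h))
  |exact: (measurable_funD measurable_fst (measurable_cst h))].
Qed.

Lemma measurable_translate_preimage e h A : measurable A ->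
  measurable (translate e h @^-1` A).
Proof.
by move=> mA; rewrite -[X in measurable X]setTI; exact: measurable_translate.
Qed.

Lemma measurable_coord e : measurable_fun setT (@coord R e).
Proof. by case: e; [exact: measurable_snd|exact: measurable_fst]. Qed.

End translations.

(* For nu with a density f, this says that the L^1 modulus of continuity of f along
   each axis is linear, i.e. that f has bounded variation. *)
Definition BV {R : realType} (nu : set (R * R) -> R) (K : R) : Prop :=
  forall e h A, measurable A -> nu (translate e h @^-1` A) <= nu A + K * `|h|.

(** * Strips around finitely many parallel lines *)

Definition nearby {R : realType} (L : seq R) (d x : R) : Prop :=
  exists2 c, c \in L & `|x - c| <= `|d|.

(** Half-open, so that consecutive bands over the same level are disjoint. *)
Definition band {R : realType} (L : seq R) (a b : R) : set R :=
  [set x | exists2 c, c \in L & c + a <= x < c + b].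

Section strips.
Context {R : realType}.
Implicit Types (L : seq R).

Lemma measurable_nearby L d : measurable [set x | nearby L d x].
Proof.
elim: L => [|c L IH].
  rewrite (_ : [set _ | _] = set0)//; apply/seteqP; split=> x //= -[c] //.
rewrite (_ : [set _ | _] = `[c - `|d|, c + `|d|] `|` [set x | nearby L d x]).
  by apply: measurableU => //; exact: measurable_itv.
apply/seteqP; split=> x /=.
  move=> [c']; rewrite inE => /orP[/eqP ->|c'L] H; last by right; exists c'.
  by left; rewrite in_itv /=; move: H; rewrite ler_norml; lra.
case=> [|[c' c'L H]]; last by exists c' => //; rewrite inE c'L orbT.
rewrite in_itv /= => H; exists c; first by rewrite inE eqxx.
by rewrite ler_norml; lra.
Qed.

Lemma measurable_band L a b : measurable (band L a b).
Proof.
elim: L => [|c L IH].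
  rewrite (_ : band _ _ _ = set0)//; apply/seteqP; split=> x //= -[c] //.
rewrite (_ : band _ _ _ = `[c + a, c + b[ `|` band L a b).
  by apply: measurableU => //; exact: measurable_itv.
apply/seteqP; split=> x /=.
  move=> [c']; rewrite inE => /orP[/eqP ->|c'L] H; last by right; exists c'.
  by left; rewrite /= in_itv.
case=> [|[c' c'L H]]; last by exists c' => //; rewrite inE c'L orbT.
by rewrite /= in_itv /= => H; exists c => //; rewrite inE eqxx.
Qed.

Lemma gap_exists L : exists2 eps : R, 0 < eps &
  forall c c', c \in L -> c' \in L -> c != c' -> eps <= `|c - c'|.
Proof.
elim: L => [|a L [eps eps0 IH]]; first by exists 1.
have [e1 e10 H1] : exists2 e1 : R, 0 < e1 &
    forall c, c \in L -> c != a -> e1 <= `|c - a|.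
  elim: L {IH} => [|b L [e1 e10 IH]]; first by exists 1.
  have [->|ba] := eqVneq b a.
    exists e1 => // c; rewrite inE => /orP[/eqP ->|]; last exact: IH.
    by rewrite eqxx.
  exists (Num.min e1 `|b - a|).
    by rewrite lt_min e10 normr_gt0 subr_eq0.
  move=> c; rewrite inE => /orP[/eqP -> _|cL ca]; rewrite ge_min ?lexx ?orbT//.
  by rewrite IH.
exists (Num.min eps e1); first by rewrite lt_min eps0.
move=> c c'; rewrite !inE => /orP[/eqP ->|cL] /orP[/eqP ->|c'L] cc'.
- by rewrite eqxx in cc'.
- by rewrite ge_min distrC H1 ?orbT// eq_sym.
- by rewrite ge_min H1 ?orbT.
- by rewrite ge_min IH.
Qed.

Context {nu : set (R * R) -> R} (cnu : is_content nu) {K : R} (bv : BV nu K).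
(** [l] stands for the coordinate along axis [e] or for x + y; by [lD] both advance at unit speed
    under translations along [e], so one argument serves both. *)
Context {l : R * R -> R} (ml : measurable_fun setT l) {e : bool}.
Context (lD : forall h z, l (translate e h z) = l z + h).

Let mb L a b : measurable (l @^-1` band L a b).
Proof. by rewrite -[X in measurable X]setTI; apply: ml => //; exact: measurable_band. Qed.

(* The band [I (a + r)] contains the disjoint union of [I r] and of [I a] moved by
   [r], so that [nu (I (a + r)) >= nu (I r) + nu (I a) - K r]; iterate this about
   [eps / r] times, the total mass being 1. *)
Lemma nearby_content_le L (eps d : R) : 0 < eps -> 0 <= K -> d != 0 ->
  (forall c c', c \in L -> c' \in L -> c != c' -> eps <= `|c - c'|) ->
  nu (l @^-1` [set x | nearby L d x]) <= (3 * K + 6 / eps) * `|d|.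
Proof.
move=> eps0 K0 d0 gap; case: (cnu) => ge0 nu1 add.
have mn : measurable (l @^-1` [set x | nearby L d x]).
  by rewrite -[X in measurable X]setTI; apply: ml => //; exact: measurable_nearby.
set eta := `|d|; have eta0 : 0 < eta by rewrite normr_gt0.
(* The closed strip around a level c has width 2 [eta]; the half-open band from c - [eta] to c + 2
   [eta] contains it. *)
pose r := 3 * eta; have r0 : 0 < r by rewrite /r; lra.
pose I a := l @^-1` band L (- eta) (- eta + a).
have step a : 0 <= a -> a + r <= eps ->
    nu (I r) + nu (I a) - K * r <= nu (I (a + r)).
  move=> a0 are.
  have mI b : measurable (I b) by exact: mb.
  have := bv e r _ (measurable_translate_preimage e (- r) _ (mI a)).
  rewrite -comp_preimage (_ : translate e (- r) \o translate e r = id); last first.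
    by apply/funext=> -[x y]; rewrite /translate/=; case: (e) => /=; congr pair; ring.
  rewrite preimage_id gtr0_norm// => H.
  have dis : I r `&` (translate e (- r) @^-1` I a) = set0.
    (* Over one level the half-open ends exclude a common point; over two levels the gap does, since
       [a + r <= eps]. *)
    apply/seteqP; split=> z //= -[[c cL H1] [c' c'L]].
    rewrite lD => H2; have [E|/(gap _ _ cL c'L)] := eqVneq c c'.
      by move: H1 H2; rewrite E; lra.
    by rewrite ler_normr; lra.
  have := add _ _ (mI r) (measurable_translate_preimage e (- r) _ (mI a)) dis.
  suff : nu (I r `|` (translate e (- r) @^-1` I a)) <= nu (I (a + r)) by lra.
  apply: (content_le cnu) => //.
    by apply: measurableU => //; exact: measurable_translate_preimage.
  move=> z [[c cL H1]|[c cL]]; last rewrite lD => H1.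
    by exists c => //; lra.
  by exists c => //; lra.
have iter n : n%:R * r <= eps -> n%:R * (nu (I r) - K * r) <= nu (I (n%:R * r)).
  elim: n => [|n IH] H; first by rewrite !mul0r ge0//; exact: mb.
  rewrite -natr1 in H *.
  have n0 : 0 <= n%:R * r by rewrite mulr_ge0// ltW.
  have := step (n%:R * r) n0; rewrite mulrDl mul1r in H; move=> /(_ H).
  rewrite !(mulrDl _ 1) !mul1r; have := IH; lra.
have HI : nu (l @^-1` [set x | nearby L d x]) <= nu (I r).
  apply: (content_le cnu) => //; first exact: mb.
  move=> z [c cL]; rewrite ler_norml -/eta => H; exists c => //.
  by rewrite /r; lra.
apply: (le_trans HI).
suff : nu (I r) - K * r <= 2 * r / eps.
  have -> : (3 * K + 6 / eps) * eta = K * r + 2 * r / eps by rewrite /r; field; rewrite gt_eqF.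
  lra.
(* Here eps < (n + 1) r. If n >= 1, then eps < 2 n r, and [iter] bounds n (nu (I r) - K r) by the
   total mass 1. If n = 0, then eps < r and nu (I r) <= 1 is enough. *)
pose n := Num.truncn (eps / r).
have /andP[n1 n2] : n%:R <= eps / r < n.+1%:R.
  by apply: truncn_itv; rewrite divr_ge0// ltW.
rewrite ler_pdivlMr// in n1; rewrite ltr_pdivrMr// -natr1 mulrDl mul1r in n2.
have := iter _ n1; have := content_le1 cnu _ (mb L (- eta) (- eta + n%:R * r)).
rewrite -/(I _) => H1 H2.
have := content_le1 cnu _ (mb L (- eta) (- eta + r)); rewrite -/(I _) => H3.
have Kr : 0 <= K * r by rewrite mulr_ge0// ltW.
rewrite ler_pdivlMr//; have [n0|n0] := eqVneq n 0%N.
  rewrite n0 mul0r in n2; nra.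
have : 1 <= n%:R :> R by rewrite ler1n lt0n.
nra.
Qed.
End strips.

(** * The piecewise affine maps, their compositions and their transfer operator *)

Definition digit {R : realType} (k : nat) (a b c : bool) : R * R :=
  if c then
    if a then if b || (k <= 3)%N then q0 R else q2 R
    else if b then if (k <= 3)%N then q0 R else q1 R
    else if (k == 1)%N || (k == 4)%N then q0 R
    else if (k == 2)%N || (k == 5)%N then q1 R else q2 R
  else
    if b then q1 R else if a then q2 R
    else if (k <= 3)%N then q1 R else q2 R.

(* On S_beta this is tau_k ([tau_tauT]); it is a total map of the plane whose
   discontinuities lie on whole lines. *)
Definition tauT {R : realType} (beta : R) (k : nat) (z : R * R) : R * R :=
  let q := digit k (z.1 < 1 / beta) (z.2 < 1 / beta) (z.1 + z.2 <= cb beta) in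
  (beta * z.1 - q.1, beta * z.2 - q.2).

(* Off the lines x = c, y = c, x + y = c for c in this list, every composition of n
   of the maps tau_k is locally an affine expansion. The same list serves the three
   directions because the digits have x, y and x + y in {0, 1}. *)
Fixpoint levels {R : realType} (beta : R) (n : nat) : seq R :=
  if n is m.+1 then
    [:: 1 / beta; cb beta] ++
      [seq c / beta | c <- levels beta m] ++
      [seq (c + 1) / beta | c <- levels beta m]
  else [::].

Definition word_map {R : realType} (beta : R) (w : seq nat) (z : R * R) :=
  foldl (fun z k => tauT beta k z) z w.

(** The law of the random orbit at time n when [nu] is its law at time 0. The recursion peels off
    the last step, so words grow at their right end. *)
Fixpoint transfer {R : realType} (beta p s t : R) (n : nat)
    (nu : set (R * R) -> R) (A : set (R * R)) : R :=
  if n is m.+1 then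
    \sum_(1 <= k < 7) prob p s t k * transfer beta p s t m nu (tauT beta k @^-1` A)
  else nu A.

Section digit.
Context {R : realType}.

Lemma digitP k a b c : [\/ digit k a b c = q0 R, digit k a b c = q1 R |
  digit k a b c = q2 R].
Proof.
rewrite /digit; repeat case: ifP => _; by [constructor 1|constructor 2|constructor 3].
Qed.

Lemma digit_coord k a b c e :
  let q : R * R := digit k a b c in coord e q = 0 \/ coord e q = 1.
Proof.
by case: (digitP k a b c) => ->; case: e => /=; [left|left|left|right|right|left].
Qed.

Lemma digit_sum k a b c : let q : R * R := digit k a b c in
  q.1 + q.2 = 0 \/ q.1 + q.2 = 1 :> R.
Proof.
by case: (digitP k a b c) => -> /=; rewrite ?addr0 ?add0r; [left|right|right].
Qed.

Context (beta : R) (beta1 : 1 < beta).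

Lemma measurable_tauT k : measurable_fun setT (tauT beta k).
Proof.
have ml1 : measurable_fun setT (fun z : R * R => z.1 < 1 / beta).
  by apply: measurable_fun_ltr => //; exact: measurable_fst.
have ml2 : measurable_fun setT (fun z : R * R => z.2 < 1 / beta).
  by apply: measurable_fun_ltr => //; exact: measurable_snd.
have ml3 : measurable_fun setT (fun z : R * R => z.1 + z.2 <= cb beta).
  apply: measurable_fun_ler => //.
  exact: (measurable_funD measurable_fst measurable_snd).
have md (P : bool -> bool -> bool -> R) : measurable_fun setT
    (fun z : R * R => P (z.1 < 1 / beta) (z.2 < 1 / beta) (z.1 + z.2 <= cb beta)).
  rewrite (_ : (fun _ => _) = fun z : R * R =>
    if z.1 < 1 / beta then
      if z.2 < 1 / beta then
        if z.1 + z.2 <= cb beta then P true true true else P true true false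
      else if z.1 + z.2 <= cb beta then P true false true else P true false false
    else if z.2 < 1 / beta then
        if z.1 + z.2 <= cb beta then P false true true else P false true false
      else if z.1 + z.2 <= cb beta then P false false true else P false false false).
    by repeat (apply: measurable_fun_ifT => //).
  by apply/funext => z; do 3 case: ifP => _.
apply: measurable_fun_pair; apply: measurable_funB.
- by apply: measurable_funM => //; exact: measurable_fst.
- exact: (md (fun a b c => (digit k a b c).1)).
- by apply: measurable_funM => //; exact: measurable_snd.
- exact: (md (fun a b c => (digit k a b c).2)).
Qed.

Lemma measurable_tauT_preimage k A :
  measurable A -> measurable (tauT beta k @^-1` A).
Proof.
by move=> mA; rewrite -[X in measurable X]setTI; exact: measurable_tauT.
Qed.

Lemma measurable_word_map w A :
  measurable A -> measurable (word_map beta w @^-1` A).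
Proof.
elim: w A => [|k w IH] A mA //.
by rewrite (_ : _ @^-1` _ = tauT beta k @^-1` (word_map beta w @^-1` A))//;
  apply: measurable_tauT_preimage; exact: IH.
Qed.

Lemma not_nearby_lt (d x c : R) : ~ `|x - c| <= `|d| -> (x + d < c) = (x < c).
Proof.
move=> H; apply/idP/idP => ?; rewrite ltNge; apply/negP => ?; apply: H;
  rewrite ler_norml; (have [?|?] := leP 0 d; [rewrite ger0_norm//|rewrite ltr0_norm//]; lra).
Qed.

Lemma not_nearby_le (d x c : R) : ~ `|x - c| <= `|d| -> (x + d <= c) = (x <= c).
Proof.
move=> H; apply/idP/idP => ?; rewrite leNgt; apply/negP => ?; apply: H;
  rewrite ler_norml; (have [?|?] := leP 0 d; [rewrite ger0_norm//|rewrite ltr0_norm//]; lra).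
Qed.

(** A move along axis [e] alters only [coord e] and x + y. Away from the lines in these two
    directions no comparison changes, so both points get the same digit. *)
Lemma tauT_translate k e d z :
  ~ nearby [:: 1 / beta; cb beta] d (coord e z) ->
  ~ nearby [:: 1 / beta; cb beta] d (z.1 + z.2) ->
  tauT beta k (translate e d z) = translate e (beta * d) (tauT beta k z).
Proof.
move=> H1 H2.
have {}H1 : ~ `|coord e z - 1 / beta| <= `|d|.
  by move=> H; apply: H1; exists (1 / beta) => //; rewrite inE eqxx.
have {}H2 : ~ `|z.1 + z.2 - cb beta| <= `|d|.
  by move=> H; apply: H2; exists (cb beta) => //; rewrite !inE eqxx orbT.
rewrite /tauT; case: e H1 => /= H1.
  rewrite (not_nearby_lt _ _ _ H1) (addrA z.1) (not_nearby_le _ _ _ H2).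
  by rewrite mulrDr [in LHS]addrAC.
rewrite (not_nearby_lt _ _ _ H1) (addrAC z.1) (not_nearby_le _ _ _ H2).
by rewrite mulrDr [in LHS]addrAC.
Qed.

Definition near_levels e n d : set (R * R) :=
  coord e @^-1` [set x | nearby (levels beta n) d x] `|`
  (fun z => z.1 + z.2) @^-1` [set x | nearby (levels beta n) d x].

(** The level c of u = beta x - q pulls back to the level (c + q) / beta of x, and distances shrink
    by beta. *)
Lemma nearby_levels_step n d x q : q = 0 \/ q = 1 ->
  nearby (levels beta n) (beta * d) (beta * x - q) -> nearby (levels beta n.+1) d x.
Proof.
have b0 : 0 < beta by apply: lt_trans beta1; exact: ltr01.
move=> q01 [c cL H]; exists ((c + q) / beta).
  rewrite /= !inE !mem_cat; apply/orP; right; apply/orP; right; apply/orP.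
  case: q01 => ->; [left|right]; rewrite ?addr0; first by apply/mapP; exists c.
  by apply/mapP; exists c.
have -> : x - (c + q) / beta = (beta * x - q - c) / beta.
  by field; rewrite gt_eqF.
rewrite normrM normfV (gtr0_norm b0) ler_pdivrMr//.
by move: H; rewrite normrM (gtr0_norm b0) (mulrC beta `|d|).
Qed.

Lemma nearby_levels_head n d x :
  nearby [:: 1 / beta; cb beta] d x -> nearby (levels beta n.+1) d x.
Proof. by move=> [c cL H]; exists c => //; rewrite mem_cat cL. Qed.

(** Induction along the word: after the first letter the displacement is beta d, and the strips of
    half-width beta |d| for the remaining letters pull back into strips of half-width |d|. *)
Lemma word_map_translate w e d z : ~ near_levels e (size w) d z ->
  word_map beta w (translate e d z) = translate e (beta ^+ size w * d) (word_map beta w z).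
Proof.
elim: w d z => [|k w IH] d z; first by rewrite mul1r.
move=> nbad; rewrite /word_map /= tauT_translate.
- rewrite -!/(word_map _ _ _) IH ?exprSr ?mulrA// => B; apply: nbad.
  case: B => B; [left|right]; apply: nearby_levels_step.
  + exact: (digit_coord k (z.1 < 1 / beta) (z.2 < 1 / beta) (z.1 + z.2 <= cb beta) e).
  + by move: B; rewrite /tauT; case: (e).
  + exact: (digit_sum k (z.1 < 1 / beta) (z.2 < 1 / beta) (z.1 + z.2 <= cb beta)).
  + by move: B; rewrite /tauT /= mulrDr opprD addrACA.
- by move=> B; apply: nbad; left; exact: nearby_levels_head.
- by move=> B; apply: nbad; right; exact: nearby_levels_head.
Qed.
End digit.

(** * The Lasota-Yorke inequality and uniform bounded variation *)

Section lasota_yorke.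
Context {R : realType} {beta p s t : R}.
Hypotheses (beta1 : 1 < beta) (p01 : 0 < p < 1).
Hypotheses (s0 : 0 < s) (t0 : 0 < t) (st1 : s + t < 1).
Local Notation transfer := (transfer beta p s t).

Let beta_gt0 : 0 < beta. Proof. by apply: lt_trans beta1; exact: ltr01. Qed.

Lemma prob_ge0 k : 0 <= prob p s t k.
Proof.
have [p0 p1] := andP p01; move: (s0) (t0) (st1) => ? ? ?.
do 7 (case: k => [|k]; first by rewrite /prob /=; rewrite ?mulr_ge0//; lra).
by [].
Qed.

Lemma sum_prob : \sum_(1 <= k < 7) prob p s t k = 1.
Proof. by rewrite unlock /prob /=; ring. Qed.

Lemma transferD m n nu : transfer (n + m) nu = transfer n (transfer m nu).
Proof.
elim: n => [//|n IH]; apply/funext => A /=.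
by apply: eq_bigr => k _; rewrite IH.
Qed.

Lemma transfer_content n nu : is_content nu -> is_content (transfer n nu).
Proof.
elim: n => [//|n IH] /IH[ge0 nu1 add]; split => /=.
- move=> A mA; apply: sumr_ge0 => k _; rewrite mulr_ge0 ?prob_ge0// ge0//.
  exact: measurable_tauT_preimage.
- under eq_bigr do rewrite preimage_setT nu1 mulr1.
  exact: sum_prob.
- move=> A B mA mB AB; rewrite -big_split /=; apply: eq_bigr => k _.
  rewrite preimage_setU add ?mulrDr//; try exact: measurable_tauT_preimage.
  by rewrite -preimage_setI AB preimage_set0.
Qed.

(** [transfer n nu A] is an average, over random words of length n, of the masses of the preimages
    of A; a bound uniform in the word survives averaging. *)
Lemma transfer_le n nu A B g :
  (forall w, size w = n ->
    nu (word_map beta w @^-1` A) <= nu (word_map beta w @^-1` B) + g) ->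
  transfer n nu A <= transfer n nu B + g.
Proof.
elim: n A B => [|n IH] A B H /=; first exact: (H [::]).
rewrite -[g in leRHS]mul1r -sum_prob mulr_suml -big_split /=.
apply: ler_sum => k _; rewrite -mulrDr ler_wpM2l ?prob_ge0//; apply: IH => w wn.
have := H (rcons w k); rewrite size_rcons wn => /(_ erefl).
have E C : word_map beta (rcons w k) @^-1` C =
    word_map beta w @^-1` (tauT beta k @^-1` C).
  by apply/seteqP; split=> z; rewrite /word_map /= foldl_rcons.
by rewrite !E.
Qed.

(** A displacement h after n steps comes from d = h / beta^n at the start. The translation by d
    costs K |d|, and the strips in each of two directions cost (3 K + 6 / eps) |d|, whence 7 = 1 + 3
    + 3 and the constant 12 / (eps beta^n). The gap eps depends only on the levels, so C does not
    depend on [nu]. *)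
Lemma lasota_yorke n : exists2 C : R, 0 <= C &
  forall (nu : set (R * R) -> R) (K : R), is_content nu -> 0 <= K -> BV nu K ->
    BV (transfer n nu) (7 / beta ^+ n * K + C).
Proof.
have [eps eps0 gap] := gap_exists (levels beta n).
have bn : 0 < beta ^+ n by rewrite exprn_gt0.
exists (12 / eps / beta ^+ n); first by rewrite !divr_ge0// ltW.
move=> nu K cnu K0 bv e h A mA.
have [->|h0] := eqVneq h 0.
  rewrite normr0 mulr0 addr0 (_ : translate e 0 = id) ?preimage_id//.
  by apply/funext=> -[x y]; rewrite /translate /= !addr0 if_same.
pose d := h / beta ^+ n.
have d0 : d != 0 by rewrite mulf_neq0// invr_neq0// gt_eqF.
have hd : `|h| = beta ^+ n * `|d|.
  by rewrite /d normrM normfV (gtr0_norm bn) mulrC divfK// gt_eqF.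
rewrite (_ : _ * `|h| = K * `|d| + ((3 * K + 6 / eps) * `|d|) *+ 2); last first.
  by rewrite hd; field; rewrite !gt_eqF.
apply: transfer_le => w wn.
have mA' := measurable_word_map beta w _ mA.
have mnb : measurable [set x | nearby (levels beta n) d x].
  exact: measurable_nearby.
have mc : measurable (coord e @^-1` [set x | nearby (levels beta n) d x]).
  by rewrite -[X in measurable X]setTI; apply: measurable_coord.
have msum : measurable_fun setT (fun z : R * R => z.1 + z.2).
  exact: (measurable_funD measurable_fst measurable_snd).
have ms : measurable ((fun z : R * R => z.1 + z.2) @^-1` [set x | nearby (levels beta n) d x]).
  by rewrite -[X in measurable X]setTI; apply: msum.
have mM : measurable (translate e d @^-1` (word_map beta w @^-1` A)).
  exact: measurable_translate_preimage.
have sub : word_map beta w @^-1` (translate e h @^-1` A) `<=`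
    (translate e d @^-1` (word_map beta w @^-1` A)) `|` near_levels beta e n d.
  move=> z /= zA; have [|nb] := pselect (near_levels beta e n d z); [by right|left].
  rewrite /= word_map_translate ?wn// (_ : _ * d = h)//.
  by rewrite /d mulrC divfK// gt_eqF.
apply: (le_trans (content_le cnu _ _ _ _ sub)).
- by apply: measurable_word_map; exact: measurable_translate_preimage.
- by apply: measurableU => //; exact: measurableU.
apply: (le_trans (content_leU cnu _ _ mM (measurableU _ _ mc ms))) => //.
rewrite addrA; apply: lerD; first exact: bv.
apply: (le_trans (content_leU cnu _ _ mc ms)); rewrite mulr2n; apply: lerD.
- apply: (nearby_content_le cnu bv (measurable_coord e) (e := e)) => // a z.
  by case: (e).
- apply: (nearby_content_le cnu bv msum (e := e)) => // a z.
  by case: (e) => /=; ring.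
Qed.

(** Take N with beta^N >= 14, so that N steps contract K by 7 / beta^N <= 1/2; iterate blocks of N
    steps, then add the remaining n mod N steps. *)
Lemma uniform_BV nu : is_content nu -> BV nu 1 ->
  exists2 K : R, 0 <= K & forall n, BV (transfer n nu) K.
Proof.
move=> cnu bv.
have /boolp.choice[C HC] : forall n, exists c : R, 0 <= c /\
  forall (nu : set (R * R) -> R) (K : R), is_content nu -> 0 <= K -> BV nu K ->
    BV (transfer n nu) (7 / beta ^+ n * K + c).
  by move=> n; have [c ? ?] := lasota_yorke n; exists c.
have [N HN] : exists N : nat, 14 <= beta ^+ N.
  have bern n : 1 + n%:R * (beta - 1) <= beta ^+ n.
    elim: n => [|n IH]; first by rewrite mul0r addr0 expr0.
    rewrite exprS -natr1; have n0 : 0 <= n%:R :> R by [].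
    move: (beta1) (mulr_ge0 n0 (sqr_ge0 (beta - 1))) => b1; nra.
  exists (Num.truncn (14 / (beta - 1))).+1; apply: le_trans (bern _).
  move: (beta1) => b1; have b0 : 0 < beta - 1 by lra.
  have := truncnS_gt (14 / (beta - 1)); rewrite ltr_pdivrMr//; lra.
have bvW m K K' : K <= K' -> BV m K -> BV m K'.
  move=> KK H e h A mA; apply: (le_trans (H e h A mA)).
  by rewrite lerD2l ler_wpM2r.
have bn n : 1 <= beta ^+ n by rewrite exprn_ege1// ltW.
(* Chosen so that K1 / 2 + C N <= K1 and 1 <= K1: blocks of N steps preserve this bound. *)
pose K1 := 1 + 2 * C N.
have CN : 0 <= C N by have [] := HC N.
have K10 : 0 <= K1 by rewrite /K1; lra.
have block q : BV (transfer (N * q) nu) K1.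
  elim: q => [|q IH]; first by rewrite muln0; apply: bvW bv; rewrite /K1; lra.
  rewrite mulnS transferD; apply: bvW; last apply: (HC N).2 IH => //.
    have : 7 / beta ^+ N <= 1 / 2.
      by rewrite ler_pdivrMr; have := bn N; lra.
    rewrite /K1; nra.
  exact: transfer_content.
have N0 : (0 < N)%N by case: N HN {CN K1 K10 block} => //; rewrite expr0; lra.
(* The remainder r < N costs at most a factor 7, as beta^r >= 1, plus C r; the sum dominates every C
   r. *)
exists (7 * K1 + \sum_(r < N) C r).
  by rewrite addr_ge0 ?mulr_ge0// sumr_ge0// => i _; have [] := HC i.
move=> n; rewrite (divn_eq n N) addnC mulnC transferD.
apply: bvW; last apply: (HC _).2 (block _) => //; last exact: transfer_content.
have rN : (n %% N < N)%N by rewrite ltn_mod.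
rewrite (bigD1 (Ordinal rN))//= addrA -[leLHS]addr0 lerD//; last first.
  by apply: sumr_ge0 => i _; have [] := HC i.
by rewrite lerD2r ler_wpM2r// ler_pdivrMr; have := bn (n %% N)%N; lra.
Qed.
End lasota_yorke.

(** * Planar Lebesgue measure and averaging over translations *)

Section lebesgue.
Context {R : realType}.
Local Notation leb := (@lebesgue_measure R).

Lemma lebesgue_measure_translation (h : R) (A : set R) : measurable A ->
  leb ((fun x => x + h) @^-1` A) = leb A.
Proof.
move=> mA; have mf : measurable_fun setT (fun x : measurableTypeR R => x + h : measurableTypeR R).
  exact: (measurable_funD (@measurable_id _ _ _) (measurable_cst h)).
suff : pushforward leb (fun x : measurableTypeR R => x + h : measurableTypeR R) A = leb A by [].
apply/esym/lebesgue_measure_unique => // _ [[a b] _ <-] /=.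
rewrite /pushforward (_ : _ @^-1` _ = `]a - h, b - h]%classic); last first.
  by apply/seteqP; split=> x /=; rewrite !in_itv /=; lra.
by rewrite !lebesgue_measure_itv /= !lte_fin ltrD2r -!EFinB; case: ifP => // _; congr EFin; ring.
Qed.

HB.instance Definition _ := Measure.copy (@leb2 R) (leb \x leb)%E.

Lemma leb2X (A B : set R) : measurable A -> measurable B ->
  @leb2 R (A `*` B) = (leb A * leb B)%E.
Proof. by move=> mA mB; rewrite /leb2 product_measure1E. Qed.

Let leb2_sigma_finite : sigma_finite setT (@leb2 R).
Proof.
have [F FT mF] := sigma_finiteT leb.
exists (fun n => \bigcup_(i < n) F i `*` \bigcup_(i < n) F i).
  apply/seteqP; split=> // -[x y] _.
  have [[i _ Fx] [j _ Fy]] : (\bigcup_i F i) x /\ (\bigcup_i F i) y.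
    by rewrite -FT.
  by exists (maxn i j).+1 => //; split; [exists i|exists j] => //=;
    rewrite ltnS ?leq_maxl ?leq_maxr.
move=> n; have mU : measurable (\bigcup_(i < n) F i).
  by apply: bigcup_measurable => i _; exact: (mF i).1.
split; first exact: measurableX.
rewrite leb2X//.
suff fin : (leb (\bigcup_(i < n) F i) < +oo)%E by rewrite lte_mul_pinfty// ge0_fin_numE.
elim: n {mU} => [|n IH]; first by rewrite bigcup_mkord big_ord0 measure0.
rewrite bigcup_mkord big_ord_recr /= -bigcup_mkord.
apply: (le_lt_trans (measureU2 leb _ _)).
- by apply: bigcup_measurable => i _; exact: (mF i).1.
- exact: (mF n).1.
- by rewrite lte_add_pinfty//; exact: (mF n).2.
Qed.

HB.instance Definition _ :=
  Measure_isSigmaFinite.Build _ _ _ (@leb2 R) leb2_sigma_finite.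

(** By uniqueness of the product measure it suffices to compare on rectangles, where only the factor
    along [e] moves. *)
Lemma leb2_translation e h (A : set (R * R)) : measurable A ->
  leb2 (translate e h @^-1` A) = leb2 A.
Proof.
move=> mA.
have mf := measurable_translate (R := R) e h.
pose RR := (measurableTypeR R * measurableTypeR R)%type.
pose m' : {measure set RR -> \bar R} :=
  pushforward (leb \x leb)%E (translate e h : RR -> RR).
suff H : forall B C, measurable B -> measurable C ->
    m' mf (B `*` C) = (leb B * leb C)%E.
  by have := @product_measure_unique _ _ _ _ _ leb leb (m' mf) H _ mA.
move=> B C mB mC; rewrite /m' /= /pushforward -/(@leb2 R).
case: (e).
  rewrite (_ : _ @^-1` _ = B `*` ((fun x => x + h) @^-1` C))//.
  rewrite leb2X ?lebesgue_measure_translation//.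
  rewrite -[X in measurable X]setTI.
  by apply: (measurable_funD (@measurable_id _ _ _) (measurable_cst h)).
rewrite (_ : _ @^-1` _ = ((fun x => x + h) @^-1` B) `*` C)//.
rewrite leb2X ?lebesgue_measure_translation//.
rewrite -[X in measurable X]setTI.
by apply: (measurable_funD (@measurable_id _ _ _) (measurable_cst h)).
Qed.

(** Apply Fubini to the pairs (z, w) with w in the square Q of side h and z + w in A. For fixed z
    the section lies in a translate of A and has area at most that of A; for fixed w in Q it is A
    moved by -w, of mass at least P A - 2 K h. Hence (P A - 2 K h) h^2 <= |A|. *)
Lemma BV_le_leb2 (P : probability (R * R)%type R) (K h : R) (A : set (R * R)) :
  0 <= K -> 0 < h -> measurable A -> BV (fun X => fine (P X)) K ->
  (P A <= (2 * K * h)%:E + ((h * h)^-1)%:E * leb2 A)%E.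
Proof.
move=> K0 h0 mA bv.
pose I := `[0, h]%classic : set R.
have mI : measurable I by exact: measurable_itv.
pose Q := I `*` I : set (R * R).
have mQ : measurable Q by exact: measurableX.
pose plus := fun x : (R * R) * (R * R) => (x.2.1 + x.1.1, x.2.2 + x.1.2).
have mplus : measurable_fun setT plus.
  apply: measurable_fun_pair => /=.
    apply: (measurable_funD (f := fun x => x.2.1) (g := fun x => x.1.1)).
      by apply: (measurableT_comp measurable_fst measurable_snd).
    by apply: (measurableT_comp measurable_fst measurable_fst).
  apply: (measurable_funD (f := fun x => x.2.2) (g := fun x => x.1.2)).
    by apply: (measurableT_comp measurable_snd measurable_snd).
  by apply: (measurableT_comp measurable_snd measurable_fst).
pose B := snd @^-1` Q `&` plus @^-1` A.
have mB : measurable B.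
  apply: measurableI; rewrite -[X in measurable X]setTI.
    by apply: measurable_snd.
  by apply: mplus.
have fubini : (\int[P]_z leb2 (xsection B z) = \int[@leb2 R]_w P (ysection B w))%E.
  rewrite -[LHS]/((P \x @leb2 R) B)%E -[RHS]/((P \x^ @leb2 R) B)%E.
  refine (@product_measure_unique _ _ _ _ _ P (@leb2 R) (P \x^ @leb2 R)%E _ B mB).
  by move=> C D mC mD; exact: product_measure2E.
have mxs z : measurable (translate true z.2 @^-1` (translate false z.1 @^-1` A)).
  by do 2 apply: measurable_translate_preimage.
have left : (\int[P]_z leb2 (xsection B z) <= leb2 A)%E.
  apply: (@le_trans _ _ (\int[P]_z (cst (leb2 A) z))%E).
    apply: ge0_le_integral => //.
    - exact: (measurable_fun_xsection (@leb2 R) mB).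
    - move=> z _ /=; have <- : leb2 (translate true z.2 @^-1` (translate false z.1 @^-1` A)) = leb2 A.
        by rewrite !leb2_translation//; exact: measurable_translate_preimage.
      apply: (@le_measure _ _ _ (@leb2 R)); rewrite ?inE//.
        exact: measurable_xsection.
        exact: mxs.
      by move=> w /xsectionP[].
  by rewrite integral_cst// [X in (_ * X)%E](probability_setT P) mule1.
pose c := fine (P A) - 2 * K * h.
have PA : P A = (fine (P A))%:E by rewrite fineK// fin_num_measure.
have sub0 : (0 <= ((h * h)^-1)%:E * leb2 A)%E.
  by apply: mule_ge0; [rewrite lee_fin invr_ge0 mulr_ge0// ltW|exact: measure_ge0].
(* For c <= 0 the claim is immediate; otherwise the constant c is a nonnegative minorant on Q. *)
have [c0|c0] := leP c 0.
  rewrite -[X in (X <= _)%E]adde0 PA; apply: leeD => //.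
  by rewrite lee_fin; move: c0; rewrite /c; lra.
have lQ : leb2 Q = (h * h)%:E.
  by rewrite leb2X// /I lebesgue_measure_itv /= lte_fin h0 -EFinB subr0.
have right : ((c * (h * h))%:E <= \int[@leb2 R]_w P (ysection B w))%E.
  apply: (@le_trans _ _ (\int[@leb2 R]_(w in Q) P (ysection B w))%E); last first.
    apply: ge0_subset_integral => //.
      exact: measurable_fun_ysection.
  apply: (@le_trans _ _ (\int[@leb2 R]_(w in Q) (cst c%:E w))%E).
    by rewrite (integral_cst (@leb2 R))// [X in (_ * X)%E]lQ EFinM.
  apply: ge0_le_integral => //.
  - by move=> *; rewrite lee_fin ltW.
  - by apply: measurable_funS (measurable_fun_ysection _ mB).
  move=> w [wx wy] /=.
  have mys : measurable (ysection B w) by exact: measurable_ysection.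
  have mw : measurable (translate false w.1 @^-1` A) by exact: measurable_translate_preimage.
  have -> : ysection B w = translate true w.2 @^-1` (translate false w.1 @^-1` A).
    apply/seteqP; split=> z.
      by move=> /ysectionP[_]; rewrite /plus /= (addrC w.1) (addrC w.2).
    rewrite /translate /= => zA; apply/ysectionP; split=> //.
    by rewrite /plus /= (addrC w.1) (addrC w.2).
  have mw' : measurable (translate true w.2 @^-1` (translate false w.1 @^-1` A)).
    exact: measurable_translate_preimage.
  rewrite -[leRHS]fineK ?fin_num_measure// lee_fin.
  have translateK e a X : translate e (- a) @^-1` (translate e a @^-1` X) = X.
    by apply/seteqP; split=> -[x y] /=; case: (e); rewrite /translate /= addrNK.
  (* Moving the translated sets back, one axis at a time, recovers A and bounds P A above by the
     mass of the section. *)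
  have := bv false (- w.1) _ mw; have := bv true (- w.2) _ mw'.
  rewrite !translateK; move: wx wy; rewrite /I /= !in_itv /= => /andP[x0 xh] /andP[y0 yh].
  rewrite !normrN !ger0_norm// /c.
  have := ler_wpM2l K0 xh; have := ler_wpM2l K0 yh; lra.
have := le_trans right (le_trans _ left); rewrite fubini lexx => /(_ isT).
rewrite PA; have hh : 0 < h * h by rewrite mulr_gt0.
have := measure_ge0 (@leb2 R) A.
case: (leb2 A) => [r| |] //.
  move=> _; rewrite lee_fin => H; rewrite -EFinM -EFinD lee_fin.
  suff : c <= (h * h)^-1 * r by rewrite /c; lra.
  by rewrite mulrC ler_pdivlMr.
by move=> _ _; rewrite gt0_muley ?lte_fin ?invr_gt0// addey ?leey.
Qed.
End lebesgue.

(** * Continuity at the empty set, countable additivity and limits along an ultrafilter *)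

Definition vanishing {R : realType} (nu : set (R * R) -> R) : Prop :=
  forall F : nat -> set (R * R), (forall n, measurable (F n)) ->
    {homo F : n m / (n <= m)%N >-> (m <= n)%O} -> \bigcap_n F n = set0 ->
    nu (F n) @[n --> \oo] --> (0 : R).

Lemma probability_of_set_function d (T : measurableType d) (R : realType) (m : set T -> \bar R)
   (m0 : m set0 = 0%E) (mge0 : forall A, (0 <= m A)%E) (msa : semi_sigma_additive m)
   (m1 : m setT = 1%E) : exists P : probability T R, forall A, P A = m A.
Proof.
pose mm := isMeasure.Build _ _ _ m m0 mge0 msa.
pose M : {measure set T -> \bar R} := HB.pack m mm.
pose pp := Measure_isProbability.Build _ _ _ M m1.
pose P : probability T R := HB.pack (M : set T -> \bar R) mm pp.
by exists P.
Qed.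

Section limit.
Context {R : realType}.

(** Compactness of [b, c] gives a cluster point l. For a neighbourhood V of l the ultrafilter
    contains the preimage of V or its complement, and clustering excludes the latter. *)
Lemma ultra_bounded_cvg (U : set_system nat) (UU : UltraFilter U) (a : nat -> R)
    (b c : R) : (forall n, b <= a n <= c) -> exists l : R, a n @[n --> U] --> l.
Proof.
move=> abc.
have Uabc : U (a @^-1` `[b, c]%classic).
  by apply: (@filterS _ U _ setT _ _ filterT) => n _; rewrite /= in_itv /=; exact: abc.
have [l [_ cl]] := @segment_compact R b c (a @ U) _ Uabc.
exists l => V lV; case: (in_ultra_setVsetC (a @^-1` V) UU) => // UV.
by have [x [/= nVx Vx]] := cl (~` V) V UV lV.
Qed.

(** The partial sums over disjoint sets differ from the mass of the union by the masses of the tails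
    [G n], which decrease to the empty set. *)
Lemma vanishing_probability (nu : set (R * R) -> R) :
  is_content nu -> vanishing nu ->
  exists P : probability (R * R)%type R,
    forall A, measurable A -> P A = (nu A)%:E.
Proof.
move=> cnu vnu; have [ge0 nu1 add] := cnu.
(* The value 0 on nonmeasurable sets makes [m] nonnegative everywhere. *)
pose m (A : set (R * R)) : \bar R := (if `[< measurable A >] then nu A else 0)%:E.
have mE A : measurable A -> m A = (nu A)%:E by move=> mA; rewrite /m asboolT.
have m0 : m set0 = 0%E by rewrite mE// (content0 cnu).
have mge0 A : (0 <= m A)%E.
  by rewrite lee_fin; case: asboolP => // mA; exact: ge0.
have msa : semi_sigma_additive m.
  move=> F mF tF mU; pose G n := \bigcup_i F i `\` \bigcup_(i < n) F i.
  have mUn n : measurable (\bigcup_(i < n) F i) by exact: bigcup_measurable.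
  have mG n : measurable (G n) by exact: measurableD.
  have sumE n : \sum_(0 <= i < n) nu (F i) = nu (\bigcup_(i < n) F i).
    elim: n => [|n IH]; first by rewrite big_geq// bigcup_mkord big_ord0 (content0 cnu).
    rewrite big_nat_recr//= IH !bigcup_mkord big_ord_recr /= -!bigcup_mkord add//.
    apply/seteqP; split=> // x [[i /= ilt Fi] Fn].
    by move: ilt; rewrite /= (tF i n I I (ex_intro _ x (conj Fi Fn))) ltnn.
  rewrite (_ : (fun n => _) = fun n => (nu (\bigcup_i F i) - nu (G n))%:E); last first.
    apply/funext => n; under eq_bigr do rewrite mE//.
    rewrite sumEFin sumE; congr EFin.
    rewrite -[X in nu X - _](@setDUK _ (\bigcup_(i < n) F i)); last by move=> x [i _ Fi]; exists i.
    rewrite add//; first by rewrite addrK.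
      exact: (mG n).
    by apply/seteqP; split=> x // [? []].
  rewrite mE//; apply: cvg_EFin; first by apply: nearW.
  rewrite -[X in _ --> X]subr0; apply: cvgB; first exact: cvg_cst.
  apply: vnu => //.
    move=> i j ij; apply/subsetPset => x [Ux nU]; split => // -[k /= ki Fk].
    by apply: nU; exists k => //=; exact: leq_trans ki ij.
  apply/seteqP; split=> // x Gx; have [[i _ Fi] _] := Gx 0%N I.
  by have [_ nU] := Gx i.+1 I; apply: nU; exists i => /=.
have m1 : m setT = 1%E by rewrite mE// nu1.
have [P PE] := probability_of_set_function _ _ _ m m0 mge0 msa m1.
by exists P => A mA; rewrite PE mE.
Qed.

(** Cesaro means are invariant up to the telescoped error (nus (n+1) A - nus 0 A) / (n + 1), and
    bounds common to all [nus n] pass to the limit. *)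
Lemma invariant_limit_content (w : nat -> R) (T : nat -> R * R -> R * R)
    (nus : nat -> set (R * R) -> R) :
  (forall k A, measurable A -> measurable (T k @^-1` A)) ->
  (forall n, is_content (nus n)) ->
  (forall n A, nus n.+1 A = \sum_(1 <= k < 7) w k * nus n (T k @^-1` A)) ->
  exists mu : set (R * R) -> R, [/\ is_content mu,
    forall A c, measurable A -> (forall n, nus n A <= c) -> mu A <= c &
    forall A, measurable A -> mu A = \sum_(1 <= k < 7) w k * mu (T k @^-1` A)].
Proof.
move=> mT cnus nusS.
(* Along one ultrafilter finer than [\oo] the means converge for all measurable sets at once. *)
have [U [UU ooU]] := @ultraFilterLemma nat \oo _.
pose avg A n := n.+1%:R^-1 * \sum_(k < n.+1) nus k A.
have n0 n : 0 < n.+1%:R^-1 :> R by rewrite invr_gt0.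
have avg_le A c : (forall n, nus n A <= c) -> forall n, avg A n <= c.
  move=> H n; rewrite /avg mulrC ler_pdivrMr//.
  apply: (@le_trans _ _ (\sum_(k < n.+1) c)); first by apply: ler_sum.
  by rewrite sumr_const card_ord mulr_natr.
have avg_ge A c : (forall n, c <= nus n A) -> forall n, c <= avg A n.
  move=> H n; rewrite /avg mulrC ler_pdivlMr//.
  apply: (@le_trans _ _ (\sum_(k < n.+1) c)); last by apply: ler_sum.
  by rewrite sumr_const card_ord mulr_natr.
pose mu A : R := lim (avg A @ U).
have muP A : measurable A -> avg A n @[n --> U] --> mu A.
  move=> mA; suff /cid[l Hl] : exists l : R, avg A n @[n --> U] --> l.
    by apply/cvg_ex; exists l.
  apply: (@ultra_bounded_cvg U UU _ 0 1) => n; apply/andP; split.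
    by apply: avg_ge => k; have [ge0 _ _] := cnus k; exact: ge0.
  by apply: avg_le => k; exact: content_le1.
exists mu; split.
- split.
  + move=> A mA; apply: limr_ge; first exact: cvgP (muP A mA).
    by apply: nearW; apply: avg_ge => k; have [ge0 _ _] := cnus k; exact: ge0.
  + apply: cvg_unique (muP _ measurableT) _ => //.
    apply: cvg_near_cst; apply: nearW => n; apply/eqP.
    by rewrite eq_le avg_le ?avg_ge// => k; have [_ -> _] := cnus k.
  + move=> A B mA mB AB.
    apply: cvg_unique (muP _ (measurableU _ _ mA mB)) _ => //.
    rewrite (_ : (fun _ => _) = avg A \+ avg B); first by apply: cvgD; exact: muP.
    apply/funext => n; rewrite /avg /= -mulrDr -big_split /=; congr (_ * _).
    by apply: eq_bigr => k _; have [_ _ ->] := cnus k.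
- move=> A c mA H; apply: limr_le; first exact: cvgP (muP A mA).
  by apply: nearW; exact: avg_le.
- move=> A mA.
  (* Both masses lie in [0, 1], so the error is at most 1 / (n + 1) in absolute value. *)
  have inv0 : n.+1%:R^-1 * (nus n.+1 A - nus 0%N A) @[n --> U] --> (0 : R).
    have hU : harmonic n @[n --> U] --> (0 : R).
      by move=> V /(@cvg_harmonic R); exact: ooU.
    apply: (squeeze_cvgr (f := fun n => - @harmonic R n) (h := @harmonic R)) => //.
      apply: nearW => n; rewrite -ler_norml normrM gtr0_norm//.
      rewrite -[leRHS]mulr1 ler_wpM2l ?invr_ge0// ler_norml.
      have [ge0 _ _] := cnus n.+1; have [ge0' _ _] := cnus 0%N.
      have := ge0 _ mA; have := ge0' _ mA.
      have := content_le1 (cnus n.+1) _ mA; have := content_le1 (cnus 0%N) _ mA; lra.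
    by rewrite -[X in _ --> X]oppr0; exact: cvgN.
  have H1 : (avg A \+ (fun n => n.+1%:R^-1 * (nus n.+1 A - nus 0%N A))) n
      @[n --> U] --> mu A + 0.
    by apply: cvgD => //; exact: muP.
  rewrite -[LHS]addr0; apply: cvg_unique H1 _ => //.
  rewrite (_ : (fun _ => _) = fun n => \sum_(1 <= k < 7) w k * avg (T k @^-1` A) n).
    apply: cvg_big => [|k _]; first exact: add_continuous.
    by apply: cvgMr; apply: muP; exact: mT.
  apply/funext => n; rewrite /avg /= -mulrDr addrA.
  have -> : \sum_(k < n.+1) nus k A + nus n.+1 A =
      nus 0%N A + \sum_(k < n.+1) nus k.+1 A.
    transitivity (\sum_(k < n.+2) nus k A); first by rewrite [RHS]big_ord_recr.
    by rewrite [LHS]big_ord_recl.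
  rewrite addrC addKr.
  rewrite (eq_bigr _ (fun (k : 'I_n.+1) _ => nusS k A)).
  rewrite exchange_big /= mulr_sumr; apply: eq_bigr => k _.
  by rewrite [RHS]mulrCA; congr (_ * _); rewrite mulr_sumr.
Qed.
End limit.

(** * The triangle and its regions *)

Section triangle.
Context {R : realType} {beta : R}.
Hypotheses (beta1 : 1 < beta) (beta32 : beta < 3 / 2).

Let db_eq : beta * cb beta = db beta.
Proof.
move: (beta1) => b1; rewrite /cb /db; field.
by apply/andP; split; rewrite gt_eqF//; lra.
Qed.

(** This amounts to 2 (beta - 1) < 1, that is beta < 3/2. *)
Let two_lt_cb : 2 / beta < cb beta.
Proof.
move: (beta1) (beta32) => b1 b2; rewrite /cb ltr_pdivrMr; last lra.
rewrite mulrC mulrA ltr_pdivlMr; first nra.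
by rewrite mulr_gt0 //; lra.
Qed.

Let inv_gt0 : 0 < 1 / beta.
Proof. by move: (beta1) => b1; rewrite divr_gt0//; lra. Qed.

Let beta_inv : beta * (1 / beta) = 1.
Proof. by move: (beta1) => b1; rewrite mulrCA divff ?mulr1// gt_eqF//; lra. Qed.

Lemma tau_tauT k z : Sb beta z -> tau beta k z = tauT beta k z.
Proof.
case: z => x y [/= x0 [y0 xy]]; rewrite /tau /tauT.
suff -> : adigit beta k (x, y) = digit k (x < 1 / beta) (y < 1 / beta) (x + y <= cb beta) by [].
have twob : 2 / beta = 1 / beta + 1 / beta by rewrite -mulrDl.
rewrite /adigit /digit.
have two := two_lt_cb.
have E0P : `[< E0 beta (x, y) >] = (x < 1 / beta) && (y < 1 / beta).
  apply/asboolP/andP; rewrite /E0 /=; first by move=> [/andP[] _ -> /andP[]].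
  by move=> [-> ->]; rewrite x0 y0.
have E1P : `[< E1 beta (x, y) >] = (y < 1 / beta) && (cb beta < x + y).
  apply/asboolP/andP; rewrite /E1 /=; first by move=> [/andP[] _ -> /andP[]].
  by move=> [-> ->]; rewrite y0 xy.
have E2P : `[< E2 beta (x, y) >] = (x < 1 / beta) && (cb beta < x + y).
  apply/asboolP/andP; rewrite /E2 /=; first by move=> [/andP[] _ -> /andP[]].
  by move=> [-> ->]; rewrite x0 xy.
have C01P : `[< C01 beta (x, y) >] = [&& 1 / beta <= x, y < 1 / beta & x + y <= cb beta].
  apply/asboolP/and3P; rewrite /C01 /=; first by move=> [-> [/andP[] _ -> ->]].
  by move=> [-> -> ->]; rewrite y0.
have C12P : `[< C12 beta (x, y) >] = [&& 1 / beta <= x, 1 / beta <= y & cb beta < x + y].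
  apply/asboolP/and3P; rewrite /C12 /=; first by move=> [-> [-> /andP[->]]].
  by move=> [-> -> ->]; rewrite xy.
have C02P : `[< C02 beta (x, y) >] = [&& x < 1 / beta, 1 / beta <= y & x + y <= cb beta].
  apply/asboolP/and3P; rewrite /C02 /=; first by move=> [/andP[] _ -> [-> ->]].
  by move=> [-> -> ->]; rewrite x0.
have C012P : `[< C012 beta (x, y) >] = [&& 1 / beta <= x, 1 / beta <= y & x + y <= cb beta].
  apply/asboolP/and3P; rewrite /C012 /=; first by move=> [-> [-> ->]].
  by move=> [-> -> ->].
rewrite E0P E1P E2P C01P C12P C02P C012P !(leNgt _ x) !(leNgt _ y) !(leNgt (x + y)).
have [xb|xb] := ltP x (1 / beta); have [yb|yb] := ltP y (1 / beta);
  have [xyb|xyb] := ltP (cb beta) (x + y) => //=.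
(* What remains is x, y < 1/beta with x + y > [cb beta], excluded by [two_lt_cb]. *)
by exfalso; lra.
Qed.

(** Digit [q0] occurs only where x + y <= [cb beta], [q1] only where x >= 1/beta, [q2] only where y
    >= 1/beta; each condition keeps the image in the triangle. *)
Lemma tauT_Sb k z : Sb beta z -> Sb beta (tauT beta k z).
Proof.
case: z => x y [/= x0 [y0 xy]]; move: (beta1) db_eq beta_inv => b1 bcb b1b.
have bx : 0 <= beta * x by rewrite mulr_ge0//; lra.
have by_ : 0 <= beta * y by rewrite mulr_ge0//; lra.
have bmono a b : a <= b -> beta * a <= beta * b by move=> ?; rewrite ler_wpM2l//; lra.
(* [db beta] is the fixed point of u -> beta u - 1, so a unit digit preserves x + y <= [db beta]. *)
have bd : beta * db beta - 1 = db beta.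
  by rewrite /db; field; rewrite gt_eqF//; lra.
have bxy : beta * x + beta * y - 1 <= db beta.
  by have := bmono _ _ xy; rewrite mulrDr; lra.
have case0 : x + y <= cb beta -> Sb beta (beta * x - 0, beta * y - 0).
  by move=> /bmono; rewrite mulrDr => ?; split; [|split] => /=; lra.
have case1 : 1 / beta <= x -> Sb beta (beta * x - 1, beta * y - 0).
  by move=> /bmono ?; split; [|split] => /=; lra.
have case2 : 1 / beta <= y -> Sb beta (beta * x - 0, beta * y - 1).
  by move=> /bmono ?; split; [|split] => /=; lra.
have two := two_lt_cb.
have twob : 2 / beta = 1 / beta + 1 / beta by rewrite -mulrDl.
rewrite /tauT /digit /=.
have [xb|xb] := ltP x (1 / beta); have [yb|yb] := ltP y (1 / beta);
  have [xyb|xyb] := leP (x + y) (cb beta);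
  rewrite /=; repeat case: ifP => _; first [exact: case0|exact: case1|exact: case2|idtac].
by exfalso; lra.
Qed.

Lemma measurable_Sb : measurable (Sb beta).
Proof.
have m1 : measurable [set z : R * R | 0 <= z.1].
  rewrite (_ : [set _ | _] = setT `&` (fst @^-1` `[0, +oo[%classic)); last first.
    by rewrite setTI; apply/seteqP; split=> z; rewrite /= in_itv /= andbT.
  by apply: measurable_fst => //; exact: measurable_itv.
have m2 : measurable [set z : R * R | 0 <= z.2].
  rewrite (_ : [set _ | _] = setT `&` (snd @^-1` `[0, +oo[%classic)); last first.
    by rewrite setTI; apply/seteqP; split=> z; rewrite /= in_itv /= andbT.
  by apply: measurable_snd => //; exact: measurable_itv.
have m3 : measurable [set z : R * R | z.1 + z.2 <= db beta].
  rewrite (_ : [set _ | _] = setT `&` ((fst \+ snd) @^-1` `]-oo, db beta]%classic)); last first.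
    by rewrite setTI; apply/seteqP; split=> z; rewrite /= in_itv.
  exact: (measurable_funD measurable_fst measurable_snd).
exact: (measurableI _ _ m1 (measurableI _ _ m2 m3)).
Qed.

Lemma leb2_Sb_lty : (leb2 (Sb beta) < +oo)%E.
Proof.
have mI : measurable `[0, db beta]%classic by exact: measurable_itv.
have sub : Sb beta `<=` `[0, db beta]%classic `*` `[0, db beta]%classic.
  by move=> [x y] [/= x0 [y0 xy]]; split; rewrite /= in_itv /=; apply/andP; split; lra.
apply: (@le_lt_trans _ _ (leb2 (`[0, db beta]%classic `*` `[0, db beta]%classic))).
  apply: (@le_measure _ _ _ (@leb2 R)); rewrite ?inE//.
    exact: measurable_Sb.
  exact: measurableX.
rewrite leb2X// lebesgue_measure_itv /=; case: ifP => _; last by rewrite mul0e.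
by rewrite -EFinB -EFinM ltry.
Qed.

End triangle.

(** * The uniform law on the unit square *)

Section unit_square.
Context {R : realType}.

Definition unit_square : set (R * R) := `[0, 1]%classic `*` `[0, 1]%classic.

Definition uniform_square (A : set (R * R)) : R := fine (leb2 (A `&` unit_square)).

Let mQ : measurable unit_square.
Proof. by apply: measurableX; exact: measurable_itv. Qed.

Let lQ : leb2 unit_square = 1%E.
Proof.
rewrite leb2X; try exact: measurable_itv.
by rewrite lebesgue_measure_itv /= lte_fin ltr01 -EFinB subr0 mule1.
Qed.

Let fin A : measurable A -> (leb2 (A `&` unit_square) \is a fin_num)%E.
Proof.
move=> mA; rewrite ge0_fin_numE; last exact: (measure_ge0 (@leb2 R)).
apply: (@le_lt_trans _ _ (leb2 unit_square)); last by rewrite lQ ltry.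
by apply: (@le_measure _ _ _ (@leb2 R)); rewrite ?inE//; exact: measurableI.
Qed.

Lemma uniform_square_content : is_content uniform_square.
Proof.
split.
- by move=> A mA; apply: fine_ge0; exact: (measure_ge0 (@leb2 R)).
- by rewrite /uniform_square setTI lQ.
- move=> A B mA mB AB; rewrite /uniform_square -fineD; try exact: fin.
  rewrite setIUl; congr fine; apply: (measureU (@leb2 R)); try exact: measurableI.
  by rewrite setIACA AB set0I.
Qed.

Lemma uniform_square_vanishing : vanishing uniform_square.
Proof.
move=> F mF ndF F0.
have mFQ n : measurable (F n `&` unit_square) by exact: measurableI.
have E : leb2 (\bigcap_n (F n `&` unit_square)) = 0%E.
  by rewrite bigcapIl; [rewrite F0 set0I (measure0 (@leb2 R))|exists 0%N].
suff : leb2 (F n `&` unit_square) @[n --> \oo] -->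
    leb2 (\bigcap_n (F n `&` unit_square)).
  by rewrite E; exact: fine_cvg.
apply: (nonincreasing_cvg_mu (mu := @leb2 R)).
- by rewrite -ge0_fin_numE ?fin//; exact: (measure_ge0 (@leb2 R)).
- exact: mFQ.
- exact: (bigcapT_measurable mFQ).
- by move=> n m nm; apply/subsetPset; apply: setSI; apply/subsetPset; exact: ndF.
Qed.

Lemma uniform_square_BV : BV uniform_square 1.
Proof.
move=> e h A mA; rewrite mul1r /uniform_square -lee_fin EFinD !fineK; last 2 first.
- exact: fin.
- by apply: fin; exact: measurable_translate_preimage.
(* Contains the points of [0, 1] that leave it under x -> x + h. For |h| > 1 it sticks out of
   [0, 1], which keeps its length equal to |h|. *)
pose J : set R := if 0 <= h then `[1 - h, 1]%classic else `[0, - h]%classic.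
have mJ : measurable J by rewrite /J; case: ifP => _; exact: measurable_itv.
have lJ : lebesgue_measure J = `|h|%:E.
  rewrite /J; case: (leP 0 h) => h0.
    rewrite ger0_norm// lebesgue_measure_itv /= lte_fin; case: ifPn => h1.
      by rewrite -EFinB; congr EFin; lra.
    by congr EFin; lra.
  rewrite ltr0_norm// lebesgue_measure_itv /= lte_fin ifT; last lra.
  by rewrite -EFinB subr0.
have mI : measurable (`[0, 1]%classic : set R) by exact: measurable_itv.
have lI : lebesgue_measure (`[0, 1]%classic : set R) = 1%E.
  by rewrite lebesgue_measure_itv /= lte_fin ltr01 -EFinB subr0.
pose W : set (R * R) := if e then `[0, 1]%classic `*` J else J `*` `[0, 1]%classic.
have mW : measurable W by rewrite /W; case: (e); exact: measurableX.
have lW : leb2 W = `|h|%:E.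
  rewrite /W; case: (e); rewrite leb2X//; first by rewrite [X in (X * _)%E]lI mul1e.
  by rewrite [X in (_ * X)%E]lI mule1.
have mAQ : measurable (A `&` unit_square) by exact: measurableI.
have mM : measurable (translate e h @^-1` (A `&` unit_square)) by exact: measurable_translate_preimage.
have sub : (translate e h @^-1` A) `&` unit_square `<=`
    (translate e h @^-1` (A `&` unit_square)) `|` W.
  clear lJ lI lW; move=> [x y] [/= Axy [/= ]]; rewrite !in_itv /= => /andP[x0 x1] /andP[y0 y1].
  have [wW|nW] := pselect (W (x, y)); [by right|left; split => //].
  move: nW; rewrite /W /J /translate /unit_square; case: (e) => /=; case: (leP 0 h) => h0;
    rewrite /= !in_itv /= => nW; split; rewrite ?x0 ?y0 ?x1 ?y1//;
    apply/andP; split; rewrite leNgt; apply/negP => ?; try lra;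
    apply: nW; split; apply/andP; split; lra.
apply: (@le_trans _ _ (leb2 ((translate e h @^-1` (A `&` unit_square)) `|` W))).
  apply: (@le_measure _ _ _ (@leb2 R)); rewrite ?inE.
  - by apply: measurableI => //; exact: measurable_translate_preimage.
  - exact: measurableU.
  exact: sub.
apply: (le_trans (measureU2 (@leb2 R) mM mW)).
by rewrite [X in (X + _ <= _)%E]leb2_translation// [X in (_ + X <= _)%E]lW.
Qed.

End unit_square.

(** * Continuity at the empty set and support along the orbit *)

Section transfer_properties.
Context {R : realType} {beta p s t : R}.
Hypotheses (beta1 : 1 < beta) (beta32 : beta < 3 / 2) (p01 : 0 < p < 1).
Hypotheses (s0 : 0 < s) (t0 : 0 < t) (st1 : s + t < 1).

Lemma transfer_vanishing n nu : vanishing nu ->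
  vanishing (transfer beta p s t n nu).
Proof.
elim: n => [//|n IH] /IH vnu F mF ndF F0 /=.
rewrite [X in _ --> X](_ : _ = \sum_(1 <= k < 7) prob p s t k * 0); last first.
  by rewrite big1// => k _; rewrite mulr0.
apply: cvg_big => [|k _]; first exact: add_continuous.
apply: cvgMr; apply: vnu.
- by move=> m; exact: measurable_tauT_preimage.
- by move=> i j ij; apply/subsetPset; apply: preimage_subset; apply/subsetPset; exact: ndF.
- by rewrite -preimage_bigcap F0 preimage_set0.
Qed.

Lemma transfer_support n nu : is_content nu -> nu (~` Sb beta) = 0 ->
  transfer beta p s t n nu (~` Sb beta) = 0.
Proof.
move=> cnu nu0; elim: n => [//|n IH] /=; rewrite big1// => k _.
have [ge0 _ _] := transfer_content p01 s0 t0 st1 n nu cnu (beta := beta).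
have mS : measurable (~` Sb beta) by apply: measurableC; exact: measurable_Sb.
have mT := measurable_tauT_preimage beta k _ mS.
rewrite (_ : transfer _ _ _ _ _ _ _ = 0) ?mulr0//; apply/eqP.
rewrite eq_le ge0// andbT -IH.
apply: (content_le (transfer_content p01 s0 t0 st1 n nu cnu)) => // z.
by apply: contra_not; exact: tauT_Sb.
Qed.

End transfer_properties.

(** * The absolutely continuous invariant measure *)

Theorem theorem5p3 (R : realType) (beta p s t : R) :
  1 < beta -> beta < 3 / 2 ->
  0 < p < 1 -> 0 < s -> 0 < t -> s + t < 1 ->
  exists mu : probability (R * R)%type R,
    mu (~` Sb beta) = 0%E /\
    mu `<< @leb2 R /\
    forall A : set (R * R), measurable A -> A `<=` Sb beta ->
      mu A = (\sum_(1 <= k < 7)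
                ((prob p s t k)%:E * mu (Sb beta `&` tau beta k @^-1` A)))%E.
Proof.
move=> b1 b32 p01 s0 t0 st1.
have cq := @uniform_square_content R.
have [K K0 bv] := uniform_BV b1 p01 s0 t0 st1 _ cq uniform_square_BV.
pose nus n := transfer beta p s t n (@uniform_square R).
have cnus n : is_content (nus n) by exact: transfer_content.
have mS : measurable (Sb beta) by exact: measurable_Sb.
have mSC : measurable (~` Sb beta) by exact: measurableC.
have mT k (A : set (R * R)) : measurable A -> measurable (tauT beta k @^-1` A).
  exact: measurable_tauT_preimage.
have nusSC n : nus n (~` Sb beta) = 0.
  apply: transfer_support => //.
  (* The unit square lies in the triangle, since x + y <= 2 < 1 / (beta - 1). *)
  rewrite /uniform_square (_ : _ `&` _ = set0) ?(measure0 (@leb2 R))//.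
  apply/seteqP; split=> // -[x y] [/= nS []]; rewrite /= !in_itv /=.
  move=> /andP[x0 x1] /andP[y0 y1]; apply: nS; split; [|split] => //=.
  rewrite /db ler_pdivlMr; last lra.
  by nra.
have finS A : measurable A -> (leb2 (A `&` Sb beta) \is a fin_num)%E.
  move=> mA; rewrite ge0_fin_numE; last exact: (measure_ge0 (@leb2 R)).
  apply: le_lt_trans (leb2_Sb_lty (beta := beta)).
  by apply: (@le_measure _ _ _ (@leb2 R)); rewrite ?inE//; exact: measurableI.
have bound n (h : R) A : 0 < h -> measurable A ->
    nus n A <= 2 * K * h + (h * h)^-1 * fine (leb2 (A `&` Sb beta)).
  move=> h0 mA; have mAS : measurable (A `&` Sb beta) by exact: measurableI.
  (* Each [nus n] is a genuine measure, so Fubini applies to it; the limit then inherits the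
     resulting bound. *)
  have vn : vanishing (nus n).
    by apply: transfer_vanishing; exact: uniform_square_vanishing.
  have [P PE] := vanishing_probability _ (cnus n) vn.
  have bP : BV (fun X => fine (P X)) K.
    move=> e d X mX; rewrite !PE//=; first exact: bv.
    exact: measurable_translate_preimage.
  have := BV_le_leb2 P K h _ K0 h0 mAS bP.
  rewrite PE// -(fineK (finS A mA)) -EFinM -EFinD lee_fin; apply: le_trans.
  have -> : nus n (A `&` Sb beta) = nus n (A `&` Sb beta) + nus n (~` Sb beta).
    by rewrite nusSC addr0.
  apply: le_trans (content_leU (cnus n) _ _ mAS mSC).
  apply: (content_le (cnus n)) => //; first exact: measurableU.
  by move=> z Az; have [?|?] := pselect (Sb beta z); [left|right].
have nusS n A : nus n.+1 A = \sum_(1 <= k < 7) prob p s t k * nus n (tauT beta k @^-1` A).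
  by rewrite /nus -addn1 addnC transferD.
have [mu [cmu mu_le mu_inv]] := invariant_limit_content (prob p s t) _ nus mT cnus nusS.
have mu_bound h A : 0 < h -> measurable A ->
    mu A <= 2 * K * h + (h * h)^-1 * fine (leb2 (A `&` Sb beta)).
  by move=> h0 mA; apply: mu_le => // n; exact: bound.
have [mu_ge0 _ mu_add] := cmu.
have muSC : mu (~` Sb beta) = 0.
  by apply/eqP; rewrite eq_le mu_ge0// andbT; apply: mu_le => // n; rewrite nusSC.
have mu_small (eps : R) : 0 < eps -> exists2 d : R, 0 < d & forall A, measurable A ->
    fine (leb2 (A `&` Sb beta)) < d -> mu A < eps.
  (* With this h the term 2 K h is below eps / 2; an area below h^2 eps / 2 does the same for the
     other term. *)
  move=> e0; pose h := eps / (2 * (2 * K + 1)).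
  have K1 : 0 < 2 * (2 * K + 1) by lra.
  have h0 : 0 < h by rewrite divr_gt0.
  have hh : 0 < h * h by rewrite mulr_gt0.
  exists (h * h * (eps / 2)); first by rewrite mulr_gt0// divr_gt0.
  move=> A mA small; apply: (le_lt_trans (mu_bound h A h0 mA)).
  have : (h * h)^-1 * fine (leb2 (A `&` Sb beta)) < eps / 2.
    by rewrite mulrC ltr_pdivrMr// mulrC.
  have hE : h * (2 * (2 * K + 1)) = eps by rewrite /h divfK// gt_eqF.
  lra.
have vmu : vanishing mu.
  (* Inside the triangle, of finite area, the areas of decreasing sets with empty intersection tend
     to 0; [mu_small] transfers this to [mu]. *)
  move=> F mF ndF F0; apply/cvgr0Pnorm_lt => eps e0.
  have [d d0 Hd] := mu_small eps e0.
  have mFS n : measurable (F n `&` Sb beta) by exact: measurableI.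
  have F0' : leb2 (\bigcap_n (F n `&` Sb beta)) = 0%E.
    by rewrite bigcapIl; [rewrite F0 set0I (measure0 (@leb2 R))|exists 0%N].
  have : leb2 (F n `&` Sb beta) @[n --> \oo] --> leb2 (\bigcap_n (F n `&` Sb beta)).
    apply: (nonincreasing_cvg_mu (mu := @leb2 R)).
    - by rewrite -ge0_fin_numE ?finS//; exact: (measure_ge0 (@leb2 R)).
    - exact: mFS.
    - exact: (bigcapT_measurable mFS).
    - by move=> n m nm; apply/subsetPset; apply: setSI; apply/subsetPset; exact: ndF.
  rewrite F0' => /fine_cvg /cvgr0Pnorm_lt /(_ d d0); apply: filterS => n /=.
  rewrite ger0_norm; last by apply: fine_ge0; exact: (measure_ge0 (@leb2 R)).
  by move=> /(Hd _ (mF n)); rewrite ger0_norm// mu_ge0.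
have [P PE] := vanishing_probability _ cmu vmu.
exists P; split; first by rewrite PE// muSC.
split.
  move=> N N0 A mA AN; rewrite PE//; congr EFin; apply/eqP.
  rewrite eq_le mu_ge0// andbT; apply/ler_addgt0Pr => eps e0; rewrite add0r ltW//.
  have [d d0] := mu_small eps e0; apply => //.
  rewrite N0//; first exact: measurableI.
  by apply: subset_trans AN; exact: subIsetl.
move=> A mA _; rewrite PE// mu_inv// -sumEFin; apply: eq_bigr => k _.
(* On the triangle [tau] is [tauT], and intersecting with the triangle loses no mass by [muSC]. *)
have -> : Sb beta `&` tau beta k @^-1` A = Sb beta `&` tauT beta k @^-1` A.
  by apply/seteqP; split=> z [Sz]; rewrite /= tau_tauT.
have mTA := mT k A mA; have mSTA : measurable (Sb beta `&` tauT beta k @^-1` A) by exact: measurableI.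
rewrite PE// EFinM; congr (_ * _%:E)%E; apply/eqP; rewrite eq_le.
rewrite (content_le cmu _ _ mSTA mTA) ?andbT//.
have := content_leU cmu _ _ mSTA mSC; rewrite muSC addr0; apply: le_trans.
apply: (content_le cmu) => //; first exact: measurableU.
by move=> z Az; have [?|?] := pselect (Sb beta z); [left|right].
Qed.
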